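(* Let $d\ge 2$, let $T\subset\mathbb R^d$ be a $d$-simplex, let $0\le s\le d$ and $0\le k\le d$, and fix an $s$-dimensional subsimplex $e\in\Delta_s(T)$. Then $$\operatorname{Alt}^k(\mathscr T^T)=\bigoplus_{\ell=\max\{s,k\}}^{\min\{k+s,d\}}\ \bigoplus_{f\in\Delta_\ell(T),\,f\supseteq e}\star_f\operatorname{Alt}^{\ell-k}(\mathscr T^e),$$ where each $\star_f\operatorname{Alt}^{\ell-k}(\mathscr T^e)\subseteq\operatorname{Alt}^k(\mathscr T^f)$ is regarded as a subspace of $\operatorname{Alt}^k(\mathscr T^T)$ via the natural embedding.
   Context: $\Delta_\ell(T)$ is the set of $\ell$-dimensional subsimplices of $T$ (including vertices for $\ell=0$ and $T$ itself for $\ell=d$). For a subsimplex $f$, $\mathscr T^f\subseteq\mathbb R^d$ is its tangent space, i.e. the linear span of differences of its vertices (so $\mathscr T^T=\mathbb R^d$ and $\mathscr T^f=\{0\}$ for a vertex). $\operatorname{Alt}^k(V)$ is the space of alternating $k$-linear forms on $V$ (with $\operatorname{Alt}^0(V)=\mathbb R$). For subspaces $W\subseteq V\subseteq\mathbb R^d$, $\operatorname{Alt}^m(W)$ is embedded in $\operatorname{Alt}^m(V)$ by pullback along the orthogonal projection $V\to W$; in particular $\operatorname{Alt}^{\ell-k}(\mathscr T^e)\subseteq\operatorname{Alt}^{\ell-k}(\mathscr T^f)$ when $e\subseteq f$. For $f\in\Delta_\ell(T)$ with a fixed orientation, $\star_f:\operatorname{Alt}^{m}(\mathscr T^f)\to\operatorname{Alt}^{\ell-m}(\mathscr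 T^f)$ is the Hodge star of the oriented Euclidean space $\mathscr T^f$. *)

(* Defs.v *)
From HB Require Import structures.
From mathcomp Require Import all_boot all_order all_algebra.
From mathcomp Require Import boolp classical_sets functions reals.

Set Implicit Arguments.
Unset Strict Implicit.
Unset Printing Implicit Defensive.

Import Order.TTheory GRing.Theory Num.Theory.
Local Open Scope ring_scope.

(* Functions of k arguments in E, encoded as functions on families 'I_k -> E. *)
Definition kfunction (R : realType) (E : lmodType R) (k : nat) : lmodType R :=
  ('I_k -> E) -> R^o.

Arguments kfunction {R} E k.

Section EuclideanSpace.
Variables (R : realType) (d : nat).
Implicit Types (u v : 'rV[R]_d) (V W : {vspace 'rV[R]_d}).

Definition dotv u v : R := \sum_(i < d) u 0 i * v 0 i.

Fact dotv_is_linear_l v : linear_for *%R (dotv^~ v).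
Proof.
move=> a x y; rewrite /dotv mulr_sumr -big_split; apply: eq_bigr => i _.
by rewrite !mxE mulrDl mulrA.
Qed.

Fact dotv_is_linear_r u : linear_for (idfun \; *%R) (dotv u).
Proof.
move=> a x y; rewrite /dotv /= mulr_sumr -big_split; apply: eq_bigr => i _.
by rewrite !mxE mulrDr mulrCA.
Qed.

HB.instance Definition _ := bilinear_isBilinear.Build R _ _ _ _ _ dotv
  (dotv_is_linear_l, dotv_is_linear_r).

Fact dotv_sym u v : dotv u v = (-1) ^+ false * idfun (dotv v u).
Proof. by rewrite mul1r; apply: eq_bigr => i _; rewrite mulrC. Qed.

HB.instance Definition _ := isHermitianSesquilinear.Build _ _ _ _ dotv dotv_sym.

Fact dotv_gt0 u : u != 0 -> 0 < dotv u u.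
Proof.
apply: contra_neqT => u0; apply/rowP => i; rewrite mxE.
have ge0 (j : 'I_d) : true -> 0 <= u 0 j * u 0 j by rewrite -expr2 sqr_ge0.
have s_eq0 : dotv u u = 0.
  apply/eqP; rewrite -[_ == 0]negbK; apply: contra u0 => s0.
  by rewrite lt0r s0 sumr_ge0.
have /eqP := psumr_eq0P ge0 s_eq0 (erefl : xpredT i).
by rewrite mulf_eq0 orbb => /eqP.
Qed.

HB.instance Definition _ := isDotProduct.Build _ _ dotv dotv_gt0.

(* For W <= V this is the orthogonal projection V -> W, between the types of  *)
(* elements of these subspaces.                                               *)
Definition oproj V W (x : subvs_of V) : subvs_of W :=
  vsproj W (daddv_pi W (orthov dotv W) (vsval x)).

(* For W <= V, the embedding of the k-forms on W into the k-forms on V.       *)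
Definition embed V W k (w : kfunction (subvs_of W) k) :
  kfunction (subvs_of V) k :=
  fun u : 'I_k -> subvs_of V => w (fun i => oproj W (u i)).

Definition is_onb V (b : (\dim V).-tuple (subvs_of V)) : Prop :=
  orthonormal dotv (map vsval b).

Definition onb V : (\dim V).-tuple (subvs_of V) :=
  xget (nseq_tuple _ 0) (@is_onb V).

Lemma onbP V : is_onb (onb V).
Proof.
suff onbV : exists b, @is_onb V b by apply: (@xgetPex _ _ (@is_onb V)).
suff [s [sV ssz so]] : exists s : seq 'rV[R]_d,
    [/\ {subset s <= V}, size s == \dim V & orthonormal dotv s].
  have szm : size (map (vsproj V) s) == \dim V by rewrite size_map.
  exists (Tuple szm); rewrite /is_onb /= -map_comp map_id_in // => x /sV.
  exact: vsprojK.
have [n] := ubnP (\dim V); elim: n => // n IH in V *; rewrite ltnS => leVn.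
have [->|V0] := eqVneq V 0%VS; first by exists [::]; rewrite dimv0.
pose x := vpick V; have x0 : x != 0 by rewrite vpick0.
have xV : x \in V by apply: memv_pick.
have xx : 0 < dotv x x by apply: dotv_gt0.
have dV : (\dim V).-1 = \dim (V :&: orthov dotv <[x]>)%VS.
  apply: eq_dim_orthov1; apply/mem_orthovPn; exists x => //.
  by rewrite lt0r_neq0.
have V_gt0 : (0 < \dim V)%N by rewrite lt0n dimv_eq0.
have [|s [sV ssz so]] := IH (V :&: orthov dotv <[x]>)%VS.
  by rewrite -dV -ltnS prednK.
exists ((Num.sqrt (dotv x x))^-1 *: x :: s); split.
- move=> y; rewrite inE => /predU1P[->|/sV]; first by rewrite memvZ.
  by rewrite memv_cap => /andP[].
- by rewrite /= (eqP ssz) -dV prednK.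
case/andP: so => s1 so; rewrite /orthonormal /= s1 so /ortho_rec /= !andbT.
apply/andP; split.
  rewrite linearZl /= linearZr /= mulrA -expr2 exprVn sqr_sqrtr ?ltW //.
  by rewrite mulVf ?lt0r_neq0.
apply/allP => y /sV; rewrite memv_cap mem_orthov1 => /andP[_ yx].
by rewrite /= linearZl /= [dotv x y]dotv_sym mul1r (eqP yx) mulr0.
Qed.

End EuclideanSpace.

Arguments oproj {R d V} W x.
Arguments embed {R d} V {W k} w.

Section AlternatingForms.
Variable R : realType.

Definition multilinear (E : lmodType R) k (w : kfunction E k) : Prop :=
  forall (u : 'I_k -> E) (i : 'I_k),
    scalar (fun x : E => w (fun j => if j == i then x else u j)).

Definition alternates (E : lmodType R) k (w : kfunction E k) : Prop :=
  forall (u : 'I_k -> E) (i j : 'I_k), i != j -> u i = u j -> w u = 0.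

Definition Alt (E : lmodType R) k : set (kfunction E k) :=
  [set w | multilinear w /\ alternates w].

(* The family w_0, ..., w_(m-1), u_0, ..., u_(p-1), when n = m + p.           *)
Definition concat (E : lmodType R) m p n (w : 'I_m -> E) (u : 'I_p -> E) :
  'I_n -> E := fun j => nth 0 (codom w ++ codom u) j.

End AlternatingForms.

Arguments Alt {R} E k.

Section HodgeStar.
Variables (R : realType) (d : nat) (V : {vspace 'rV[R]_d}).

(* An orientation of the Euclidean space V is given by its volume form, i.e.  *)
(* by one of the two top-degree forms whose square is the Gram determinant:   *)
(* they are those equal to 1 or -1 on each orthonormal basis. When V = 0 they *)
(* are the constants 1 and -1.                                                *)
Definition volume_form (vol : kfunction (subvs_of V) (\dim V)) : Prop :=
  Alt _ _ vol /\ forall u : 'I_(\dim V) -> subvs_of V,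
    vol u ^+ 2 = \det (\matrix_(i, j) dotv (vsval (u i)) (vsval (u j))).

(* Hodge star of an m-form w on V oriented by vol, a p-form for m + p = \dim V*)
(* (the only case in which it is meaningful). With n = \dim V and for any     *)
(* orthonormal basis b of V, which need not be positively oriented,           *)
(*   (star w)(u_1, ..., u_p) =                                                *)
(*     1/m! \sum_(i_1, ..., i_m < n)                                          *)
(*       w(b_(i_1), ..., b_(i_m)) vol(b_(i_1), ..., b_(i_m), u_1, ..., u_p),  *)
(* that is, star w is the p-form such that a /\ star w = <a, w> vol for all   *)
(* m-forms a.                                                                 *)
Definition hodge (vol : kfunction (subvs_of V) (\dim V)) m p
    (w : kfunction (subvs_of V) m) : kfunction (subvs_of V) p :=
  fun u => (m`!%:R)^-1 * \sum_(i : {ffun 'I_m -> 'I_(\dim V)})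
    let bi := fun a => tnth (onb V) (i a) in w bi * vol (concat bi u).

End HodgeStar.

Arguments hodge {R d V} vol {m p} w.

Section Simplices.
Variables (R : realType) (d : nat) (v : 'I_d.+1 -> 'rV[R]_d).

(* v lists the vertices of a nondegenerate d-simplex of R^d.                  *)
Definition is_simplex : bool :=
  free [tuple v (lift ord0 i) - v ord0 | i < d].

(* Subsimplices are given by their sets of vertices.                          *)
Definition subsimplices (l : nat) : {set {set 'I_d.+1}} :=
  [set f : {set 'I_d.+1} | #|f| == l.+1].

Definition tangent (f : {set 'I_d.+1}) : {vspace 'rV[R]_d} :=
  <<[seq v j - v i | i <- enum f, j <- enum f]>>%VS.

End Simplices.

Section DirectSum.
Local Open Scope classical_set_scope.
Variables (R : realType) (U : lmodType R).

Definition subspace (A : set U) : Prop :=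
  A 0 /\ forall (a : R) (x y : U), A x -> A y -> A (a *: x + y).

(* A is the internal direct sum of the subspaces S i, for i such that P i.    *)
Definition is_direct_sum (A : set U) (I : finType) (P : pred I)
    (S : I -> set U) : Prop :=
  [/\ forall i, P i -> subspace (S i),
      A = [set \sum_(i | P i) x i | x in [set x | forall i, P i -> S i (x i)]] &
      forall x : I -> U, (forall i, P i -> S i (x i)) ->
        \sum_(i | P i) x i = 0 -> forall i, P i -> x i = 0].

End DirectSum.

Arguments is_direct_sum {R U} A {I} P S.

(* Main.v *)
(* Write E for the tangent space of [e], let [u] be an orthonormal basis of E,
   and let n_j be the gradient of the barycentric coordinate of the vertex j.
   The vectors u_a together with the n_j, j not in [e], form a basis of R^d, so
   an alternating k-form is determined by its values on the k-subsets of this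
   family. If [f] contains [e], the orthogonal projection on the tangent space
   of [f] kills n_j for j not in [f], and sends the u_a and the other n_j to a
   basis D_f. For a form a on E of degree m = l - k,
     (star_f a)(z) = 1/m! \sum_t a(u_t) vol_f(u_t, P_f z),
   t ranging over the m-tuples. Hence star_f a vanishes on a k-subset B unless
   u_t and P_f B make up D_f for some t, which forces f to be the union of [e]
   and of the vertices j such that n_j is in B. Conversely, if B satisfies this
   condition, a := vol_f(., P_f B) gives a form whose value at B is a nonzero
   sum of squares, and which vanishes on every other k-subset. The sum is
   therefore direct, and it exhausts the k-forms. *)

Require Import Defs.
From HB Require Import structures.
From mathcomp Require Import all_boot all_order all_algebra perm.
From mathcomp Require Import boolp classical_sets functions reals.

Set Implicit Arguments.
Unset Strict Implicit.
Unset Printing Implicit Defensive.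

Import Order.TTheory GRing.Theory Num.Theory.
Local Open Scope classical_set_scope.
Local Open Scope ring_scope.

(** * Multilinear algebra *)

Section Subspaces.
Variables (R : realType) (U : lmodType R).

Lemma subspaceZD (A : set U) (a : R) (x y : U) :
  subspace A -> A x -> A y -> A (a *: x + y).
Proof. by case=> _; apply. Qed.

Lemma subspace_image (V : lmodType R) (A : set U) (L : U -> V) :
  linear L -> subspace A -> subspace (L @` A).
Proof.
move=> lL [A0 AD]; split=> [|c _ _ [x Ax <-] [y Ay <-]].
  by exists 0 => //; have := lL (-1) 0 0; rewrite scaler0 addr0 scaleN1r addNr.
by exists (c *: x + y); [apply: AD|rewrite lL].
Qed.

Lemma subspace_sum (A : set U) (Q : finType) (P : pred Q) (c : Q -> R)
    (x : Q -> U) :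
  subspace A -> (forall q, P q -> A (x q)) -> A (\sum_(q | P q) c q *: x q).
Proof.
move=> sA Ax; elim/big_rec: _ => [|q y Pq Ay]; first by case: sA.
by apply: subspaceZD => //; apply: Ax.
Qed.

Lemma scalar_sum (f : U -> R) (lf : scalar f) (Q : finType) (P : pred Q)
    (c : Q -> R) (x : Q -> U) :
  f (\sum_(q | P q) c q *: x q) = \sum_(q | P q) c q * f (x q).
Proof.
 elim/big_rec2: _ => [|q a y _ <-]; last by rewrite lf.
by have := lf (-1) 0 0; rewrite scaler0 addr0 mulN1r addNr.
Qed.

(** The functionals [ev q] separate the points of [A], and each has a dual vector in the summand
    [cls q]. Expanding along the dual vectors and grouping by class gives the sum; since [ev q] sees
    no summand other than [cls q], applying it to a vanishing sum isolates one component. *)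
Lemma direct_sum_dual_family (A : set U) (I : finType) (P : pred I)
    (S : I -> set U) (Q : finType) (D : pred Q) (ev : Q -> U -> R)
    (cls : Q -> I) :
    subspace A ->
    (forall i, P i -> subspace (S i) /\ S i `<=` A) ->
    (forall q, scalar (ev q)) ->
    (forall x, A x -> (forall q, D q -> ev q x = 0) -> x = 0) ->
    (forall q, D q -> P (cls q)) ->
    (forall i q x, P i -> D q -> S i x -> ev q x != 0 -> cls q = i) ->
    (forall q, D q -> exists2 x, S (cls q) x &
       ev q x != 0 /\ forall q', D q' -> q' != q -> ev q' x = 0) ->
  is_direct_sum A P S.
Proof.
move=> sA SA evl evA clsP evS dual.
have ev0 q : ev q 0 = 0.
  by have := evl q (-1) 0 0; rewrite scaler0 addr0 mulN1r addNr.
have evD q x y : ev q (x + y) = ev q x + ev q y.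
  by rewrite -{1}[x]scale1r evl mul1r.
have evZ q a x : ev q (a *: x) = a * ev q x.
  by rewrite -[a *: x]addr0 evl ev0 addr0.
have ev_sum q J (r : seq J) (T : pred J) F :
    ev q (\sum_(j <- r | T j) F j) = \sum_(j <- r | T j) ev q (F j).
  by elim/big_ind2: _ => // x1 x2 y1 y2 <- <-.
split=> [i /SA[]//||x Sx x0 i Pi].
- apply/seteqP; split=> [w Aw|_ [x Sx <-]]; last first.
    rewrite -[X in A X](eq_bigr _ (fun i _ => scale1r (x i))).
    by apply: subspace_sum => // i Pi; apply: (SA i Pi).2; apply: Sx.
  have /choice[phi phiP] q : exists x, D q -> [/\ S (cls q) x, ev q x != 0 &
      forall q', D q' -> q' != q -> ev q' x = 0].
    have [/dual[x ? []]|] := boolP (D q); first by exists x.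
    by exists 0.
  (* The dual vectors are not normalized, hence the division. *)
  pose c q := ev q w / ev q (phi q).
  pose y i := \sum_(q | D q && (cls q == i)) c q *: phi q.
  have Sy i : P i -> S i (y i).
    move=> Pi; apply: subspace_sum; first by case: (SA i Pi).
    by move=> q /andP[Dq /eqP<-]; case: (phiP q Dq).
  have Ay : A (\sum_(i | P i) y i).
    rewrite -[X in A X](eq_bigr _ (fun i _ => scale1r (y i))).
    by apply: subspace_sum => // i Pi; apply: (SA i Pi).2; apply: Sy.
  (* The difference of the two sides lies in [A] and is killed by every [ev q] with q in [D]. *)
  exists y => //; apply/eqP; rewrite -subr_eq0; apply/eqP; apply: evA => [|q Dq].
    by rewrite addrC -scaleN1r; apply: subspaceZD.
  have -> : \sum_(i | P i) y i = \sum_(q | D q) c q *: phi q.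
    by rewrite [RHS](partition_big cls P).
  rewrite evD -scaleN1r evZ mulN1r ev_sum (bigD1 q) //= big1 => [|p /andP[Dp pq]].
    by rewrite addr0 evZ divfK ?subrr //; case: (phiP q Dq).
  by rewrite evZ; case: (phiP p Dp) => _ _ -> //; rewrite ?mulr0 // eq_sym.
- apply: evA => [|q Dq]; first by apply: (SA i Pi).2; apply: Sx.
  apply/eqP; apply: contraT => ne0; have qi := evS _ _ _ Pi Dq (Sx _ Pi) ne0.
  have := ev0 q; rewrite -x0 ev_sum (bigD1 i) //= big1 ?addr0 => [e0|j /andP[Pj ji]].
    by rewrite e0 eqxx in ne0.
  apply/eqP; apply: contraNT ji => nej.
  by rewrite -(evS _ _ _ Pj Dq (Sx _ Pj) nej) qi.
Qed.

End Subspaces.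

Lemma map_codom (T : finType) (A B : Type) (g : A -> B) (h : T -> A) :
  map g (codom h) = codom (g \o h).
Proof. by rewrite /codom /image_mem -[LHS]map_comp. Qed.

(** * Alternating forms evaluated on sequences of vectors *)

Section AlternatingForms.
Variable R : realType.
Implicit Types E : lmodType R.

(** Arguments held in a sequence can be concatenated, permuted and peeled off one at a time. The
    default 0 is never read when the sequence has length [k]. *)
Definition on_seq E k (w : kfunction E k) (s : seq E) : R :=
  w (fun i => nth 0 s i).

(** Since [F] is any function of sequences, linearity is required only at total length [k]. Fixing
    the head lowers the degree by one, which the inductions on [k] use. *)
Definition slot_linear E k (F : seq E -> R) : Prop :=
  forall p q, (size p + size q).+1 = k -> scalar (fun x => F (p ++ x :: q)).

Lemma nth_codom_ord E k (u : 'I_k -> E) (i : 'I_k) : nth 0 (codom u) i = u i.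
Proof. by rewrite (nth_map i) ?size_enum_ord // nth_ord_enum. Qed.

Lemma on_seq_codom E k (w : kfunction E k) u : on_seq w (codom u) = w u.
Proof.
by congr w; apply/funext => i; rewrite nth_codom_ord.
Qed.

Lemma codom_nth E k (s : seq E) : size s = k -> codom (fun i : 'I_k => nth 0 s i) = s.
Proof.
move=> sk; apply: (@eq_from_nth _ 0); first by rewrite size_codom card_ord.
move=> i; rewrite size_codom card_ord => ik.
by rewrite (nth_map (Ordinal ik)) ?size_enum_ord // nth_enum_ord.
Qed.

Lemma nth_slot E k (p q : seq E) (x : E) (i : 'I_k) : i = size p :> nat ->
  (fun j : 'I_k => nth 0 (p ++ x :: q) j) =
  (fun j : 'I_k => if j == i then x else nth 0 (p ++ 0 :: q) j).
Proof.
move=> ip; apply/funext => j; rewrite !nth_cat -val_eqE /= ip.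
case: ltngtP => //= [lt|->]; last by rewrite subnn.
by case E1 : (j - size p)%N => //; move/eqP: E1; rewrite subn_eq0 leqNgt lt.
Qed.

Lemma multilinear_slot E k (w : kfunction E k) :
  multilinear w -> slot_linear k (on_seq w).
Proof.
move=> ml p q spq a x y.
have lt : (size p < k)%N by rewrite -spq ltnS leq_addr.
by rewrite /on_seq !(@nth_slot _ _ _ _ _ (Ordinal lt)) // ml.
Qed.

Lemma slot_linear_cons E k (F : seq E -> R) x :
  slot_linear k.+1 F -> slot_linear k (fun s => F (x :: s)).
Proof. by move=> sF p q spq; apply: (sF (x :: p)); rewrite addSn spq. Qed.

Lemma slot_linear0 E k (F : seq E -> R) (s : seq E) :
  slot_linear k F -> size s = k -> 0 \in s -> F s = 0.
Proof.
move=> sF + /path.splitPr s0; case: s0 => p q; rewrite size_cat addnS => spq.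
by have := sF p q spq (-1) 0 0; rewrite scaler0 addr0 mulN1r addNr.
Qed.

Lemma on_seq_uniq E (I : eqType) k (w : kfunction E k) (x : I -> E) (W : seq I) :
  Alt E k w -> size W = k -> on_seq w [seq x i | i <- W] != 0 -> uniq W.
Proof.
move=> [_ alt] sW; apply: contraNT => nu; case: W nu sW => // i0 W nu sW.
have /(uniqPn i0)[i [j [ij jW e]]] := nu.
have jk : (j < k)%N by rewrite -sW.
have ik : (i < k)%N by apply: ltn_trans jk.
apply/eqP; apply: (alt (fun i : 'I_k => nth 0 [seq x i | i <- i0 :: W] i)
  (Ordinal ik) (Ordinal jk)).
  by rewrite -val_eqE /= ltn_eqF.
by rewrite !(nth_map i0) ?e // (ltn_trans ij).
Qed.

(** Polarization: with u i + u j in both slots the form vanishes, and its expansion leaves only the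
    two mixed terms. *)
Lemma alternating_swap E k (w : kfunction E k) (u : 'I_k -> E) i j :
  Alt E k w -> i != j -> w (u \o tperm i j) = - w u.
Proof.
move=> [ml alt] ij.
pose h a b := w (fun l => if l == i then a else if l == j then b else u l).
have hl a b c : h (a + b) c = h a c + h b c.
  rewrite /h; set u' := fun l => if l == j then c else u l.
  by have := ml u' i 1 a b; rewrite scale1r mul1r.
have hr c a b : h c (a + b) = h c a + h c b.
  (* As i and j differ, the two updates commute, so linearity in slot j applies. *)
  have sw y z : h y z = w (fun l => if l == j then z else if l == i then y else u l).
    congr w; apply/funext => l; case: (eqVneq l i) => // ->.
    by rewrite (negPf ij).
  rewrite !sw; set u' := fun l => if l == i then c else u l.
  by have := ml u' j 1 a b; rewrite scale1r mul1r.
have hd a : h a a = 0.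
  by apply: (alt _ i j ij); rewrite !eqxx eq_sym (negPf ij).
have := hd (u i + u j); rewrite hl !hr !hd add0r addr0 => /eqP.
rewrite addrC addr_eq0 => /eqP e; have -> : w u = h (u i) (u j).
  congr w; apply/funext => l; case: eqVneq => [->//|_].
  by case: eqVneq => [->|].
rewrite -e; congr w; apply/funext => l /=; case: tpermP => [->|->|].
- by rewrite eqxx.
- by rewrite eqxx eq_sym (negPf ij).
- by move=> /eqP/negPf-> /eqP/negPf->.
Qed.

(** Only vanishing is transported, so no sign has to be tracked: a permutation is a product of
    transpositions, each of which negates the value. *)
Lemma alternating_perm_eq0 E k (w : kfunction E k) (u : 'I_k -> E) (s : 'S_k) :
  Alt E k w -> w u = 0 -> w (u \o s) = 0.
Proof.
move=> Aw; have [ts -> /allP ts_dpair] := prod_tpermP s.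
elim: ts ts_dpair u => [|t ts IH] dp u wu0.
  by rewrite big_nil (_ : u \o _ = u) //; apply/funext => i /=; rewrite perm1.
rewrite big_cons (_ : u \o _ = (u \o \prod_(t <- ts) tperm t.1 t.2)%g \o
    tperm t.1 t.2); last by apply/funext => i; rewrite /= permM.
rewrite alternating_swap //; last by apply: (dp t); rewrite inE eqxx.
by rewrite IH ?oppr0 // => t' t'ts; apply: dp; rewrite inE t'ts orbT.
Qed.

Lemma on_seq_perm_eq0 E (I : eqType) k (w : kfunction E k) (x : I -> E)
    (W W' : seq I) :
  Alt E k w -> size W = k -> perm_eq W' W ->
  on_seq w [seq x i | i <- W] = 0 -> on_seq w [seq x i | i <- W'] = 0.
Proof.
move=> Aw sW pW w0; have sW' : size W == k by rewrite sW.
have [s e] : exists s : 'S_k, W' = [tuple tnth (Tuple sW') (s i) | i < k].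
  exact/tuple_permP.
rewrite -[RHS](alternating_perm_eq0 s Aw w0); congr (w _); apply/funext => i /=.
have i0 : I by apply: tnth (Tuple sW') i.
have sWk : size W' = k by rewrite (perm_size pW).
rewrite !(nth_map i0) ?sWk ?sW ?ltn_ord // {1}e -tnth_nth tnth_mktuple.
by rewrite (tnth_nth i0).
Qed.

(** Induction on [k]: the head argument is expanded in the family, and with a member of the family
    as head the remaining function has one slot fewer. *)
Lemma slot_linear_spanned_eq0 E (I : finType) k (F : seq E -> R) (x : I -> E) :
    slot_linear k F -> (forall y, exists c : I -> R, y = \sum_i c i *: x i) ->
    (forall W : seq I, size W = k -> F [seq x i | i <- W] = 0) ->
  forall s, size s = k -> F s = 0.
Proof.
move=> sF span; elim: k F sF => [|k IH] F sF F0 [|y s] //= => [_|[sk]].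
  exact: (F0 [::]).
have lin z1 z2 a : F ((a *: z1 + z2) :: s) = a * F (z1 :: s) + F (z2 :: s).
  by apply: (sF [::] s); rewrite sk.
have [c ->] := span y; elim/big_rec: _ => [|i z _ z0].
  by apply: (slot_linear0 sF); rewrite /= ?sk // inE eqxx.
rewrite lin z0 (IH (fun s => F (x i :: s))) ?mulr0 ?addr0 //.
  exact: slot_linear_cons.
by move=> W sW; apply: (F0 (i :: W)); rewrite /= sW.
Qed.

(** * Forms tested on a spanning family *)

Section SpanningFamily.
Variables (E : lmodType R) (I : finType) (x : I -> E) (D : {set I}).
Hypothesis span : forall y, exists c : I -> R, y = \sum_i c i *: x i.
Hypothesis x0 : forall i, i \notin D -> x i = 0.

(** Words with a repeated index vanish by alternation, those leaving [D] contain the vector 0, and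
    any other word is a rearrangement of a k-subset of [D]. *)
Lemma Alt_spanned_eq0 k (w : kfunction E k) : Alt E k w ->
    (forall B : {set I}, B \subset D -> #|B| = k ->
       on_seq w [seq x i | i <- enum B] = 0) ->
  w = 0.
Proof.
move=> Aw w0; have sw := multilinear_slot Aw.1.
apply/funext => u; rewrite -[w u]on_seq_codom.
apply: (slot_linear_spanned_eq0 sw span); last by rewrite size_codom card_ord.
move=> W sW; apply/eqP; apply: contraT => ne0.
have uW := on_seq_uniq Aw sW ne0.
have pW : perm_eq W (enum [set i in W]).
  by apply: uniq_perm => [//||i]; rewrite ?enum_uniq // mem_enum inE.
have cW : #|[set i in W]| = k by rewrite cardE -(perm_size pW).
have WD : [set i in W] \subset D.
  apply/fintype.subsetP => i; rewrite inE => iW; apply: contraNT ne0 => /x0 xi0.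
  by apply/eqP; apply: (slot_linear0 sw); rewrite ?size_map -?xi0 ?map_f.
by rewrite -(negPf ne0); apply/eqP/(on_seq_perm_eq0 Aw _ pW (w0 _ WD cW));
  rewrite -cardE.
Qed.

(** In top degree [D] is its own only k-subset, so a form vanishing on [D] would vanish
    everywhere. *)
Lemma on_seq_spanning_neq0 k (w : kfunction E k) (W : seq I) :
  Alt E k w -> w <> 0 -> #|D| = k -> size W = k ->
  (on_seq w [seq x i | i <- W] != 0) = perm_eq W (enum D).
Proof.
move=> Aw w0 cD sW; have sw := multilinear_slot Aw.1.
apply/idP/idP => [ne0|pW].
  have uW := on_seq_uniq Aw sW ne0.
  apply: uniq_perm => //; first exact: enum_uniq.
  have WD : {subset W <= enum D}.
    move=> i iW; rewrite mem_enum; apply: contraNT ne0 => /x0 xi0.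
    by apply/eqP; apply: (slot_linear0 sw); rewrite ?size_map -?xi0 ?map_f.
  by apply: (uniq_min_size uW WD _).2; rewrite sW -cardE cD.
apply/eqP => W0; apply: w0; apply: Alt_spanned_eq0 => // B BD cB.
have -> : B = D by apply/eqP; rewrite eqEcard BD cB cD leqnn.
by apply: (on_seq_perm_eq0 Aw sW) W0; rewrite perm_sym.
Qed.

End SpanningFamily.

Lemma Alt_subspace E k : subspace (Alt E k).
Proof.
split=> [|a w1 w2 [ml1 alt1] [ml2 alt2]]; split=> //.
- by move=> u i c y z; rewrite mulr0 addr0.
- move=> u i c y z.
  rewrite -[LHS]/(a * w1 _ + w2 _) -[X in c * X]/(a * w1 _ + w2 _).
  rewrite -[X in _ = _ + X]/(a * w1 _ + w2 _) ml1 ml2.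
  by rewrite !mulrDr !mulrA [a * c]mulrC addrACA.
- move=> u i j ij uij; rewrite -[LHS]/(a * w1 u + w2 u).
  by rewrite (alt1 _ _ _ ij) ?(alt2 _ _ _ ij) ?mulr0 ?addr0.
Qed.

(** Changing argument i of [z] changes only slot size p + i of the full family. This serves both to
    show that stars are alternating and to build the forms dual to k-subsets. *)
Lemma Alt_insert E E' k n (w : kfunction E n) (L : {linear E' -> E})
    (p q : seq E) :
  Alt E n w -> (size p + k + size q)%N = n ->
  Alt E' k (fun z => on_seq w (p ++ codom (L \o z) ++ q)).
Proof.
move=> [ml alt] spq.
have ilt (i : 'I_k) : (size p + i < n)%N.
  by rewrite -spq -addnA ltn_add2l ltn_addr.
pose G (z : 'I_k -> E') := fun j : 'I_n => nth 0 (p ++ codom (L \o z) ++ q) j.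
have Gi z (i : 'I_k) : G z (Ordinal (ilt i)) = L (z i).
  rewrite /G nth_cat /= ltnNge leq_addr addKn nth_cat size_codom card_ord ltn_ord.
  exact: nth_codom_ord.
have Gj z (i : 'I_k) y (j : 'I_n) : j != Ordinal (ilt i) ->
    G (fun l => if l == i then y else z l) j = G z j.
  rewrite /G !nth_cat -val_eqE /= !size_codom card_ord => jn.
  case: ltnP => // pj; case: ltnP => // jk.
  pose o := Ordinal jk; have -> : (j - size p)%N = o by [].
  rewrite !nth_codom_ord /=.
  case: eqVneq => // oi; case/eqP: jn; rewrite -oi /=.
  by rewrite subnKC.
split=> [u i a y z|u i j ij uij].
  have upd y' : G (fun l => if l == i then y' else u l) =
      fun j => if j == Ordinal (ilt i) then L y' else G u j.
    apply/funext => j; case: eqVneq => [->|/Gj//].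
    by rewrite Gi eqxx.
  by rewrite /on_seq -!/(G _) !upd linearP ml.
apply: (alt (G u) (Ordinal (ilt i)) (Ordinal (ilt j))).
  by rewrite -val_eqE /= eqn_add2l.
by rewrite !Gi uij.
Qed.

Lemma sum_ffun_tuple (V : nmodType) (J : finType) m (F : seq J -> V) :
  \sum_(i : {ffun 'I_m -> J}) F (codom i) = \sum_(t : m.-tuple J) F t.
Proof.
rewrite (reindex (fun t : m.-tuple J => [ffun a => tnth t a])) /=.
  apply: eq_bigr => t _; congr F; rewrite -[RHS]map_tnth_enum.
  by apply: eq_map => a; rewrite ffunE.
exists (fun i : {ffun 'I_m -> J} => [tuple i a | a < m]) => [t|i] _.
  by apply: eq_from_tnth => a; rewrite tnth_mktuple ffunE.
by apply/ffunP => a; rewrite ffunE tnth_mktuple.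
Qed.

Lemma sum_tupleS (V : nmodType) (J : finType) m (F : seq J -> V) :
  \sum_(t : m.+1.-tuple J) F t = \sum_j \sum_(t : m.-tuple J) F (j :: t).
Proof.
rewrite pair_bigA /= (reindex (fun p : J * m.-tuple J => [tuple of p.1 :: p.2])) //.
exists (fun t : m.+1.-tuple J => (thead t, [tuple of behead t])) => [[j t]|t] _.
  by congr (_, _); apply: val_inj.
by rewrite -tuple_eta.
Qed.

Lemma sum_tuple0 (V : nmodType) (J : finType) (F : seq J -> V) :
  \sum_(t : 0.-tuple J) F t = F [::].
Proof.
rewrite (eq_bigr (fun=> F [::])) => [|t _]; last by rewrite tuple0.
by rewrite big_const card_tuple expn0 /= addr0.
Qed.

(** The hypothesis says that the sums of the tensors x1 i (x) x2 i and y1 j (x) y2 j cannot be told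
    apart by pairs of functionals; the conclusion is the m-fold version, obtained by replacing one
    tensor factor at a time. *)
Lemma contraction E1 E2 (I J : finType) (x1 : I -> E1) (x2 : I -> E2)
    (y1 : J -> E1) (y2 : J -> E2) m (F1 : seq E1 -> R) (F2 : seq E2 -> R) :
    (forall (f : E1 -> R) (g : E2 -> R), scalar f -> scalar g ->
       \sum_i f (x1 i) * g (x2 i) = \sum_j f (y1 j) * g (y2 j)) ->
    slot_linear m F1 -> slot_linear m F2 ->
  \sum_(t : m.-tuple I) F1 (map x1 t) * F2 (map x2 t) =
  \sum_(t : m.-tuple J) F1 (map y1 t) * F2 (map y2 t).
Proof.
move=> H; elim: m F1 F2 => [|m IH] F1 F2 s1 s2.
  rewrite (sum_tuple0 (fun t => F1 (map x1 t) * F2 (map x2 t))).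
  by rewrite (sum_tuple0 (fun t => F1 (map y1 t) * F2 (map y2 t))).
rewrite (sum_tupleS _ (fun t => F1 (map x1 t) * F2 (map x2 t))).
rewrite (sum_tupleS _ (fun t => F1 (map y1 t) * F2 (map y2 t))) /=.
(* The tail is replaced first, with the head fixed; after exchanging the sums the head is replaced
   with the tail fixed. *)
rewrite (eq_bigr (fun i => \sum_(t : m.-tuple J)
    F1 (x1 i :: map y1 t) * F2 (x2 i :: map y2 t))) => [|i _]; last first.
  by rewrite (IH (F1 \o cons _) (F2 \o cons _)) //; apply: slot_linear_cons.
rewrite exchange_big [RHS]exchange_big; apply: eq_bigr => t _ /=.
rewrite (H (fun x => F1 (x :: _)) (fun x => F2 (x :: _))) // => a x y.
  by apply: (s1 [::]); rewrite size_map size_tuple.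
by apply: (s2 [::]); rewrite size_map size_tuple.
Qed.

End AlternatingForms.

(** * Euclidean geometry of the simplex *)

Section Projections.
Variables (R : realType) (d : nat).
Implicit Types (y z w : 'rV[R]_d) (V W : {vspace 'rV[R]_d}).

Lemma dotvC y z : dotv y z = dotv z y.
Proof. by rewrite dotv_sym mul1r. Qed.

Lemma dotvZl a y z : dotv (a *: y) z = a * dotv y z.
Proof. exact: linearZl_LR. Qed.

Lemma dotvZr a y z : dotv y (a *: z) = a * dotv y z.
Proof. exact: linearZr_LR. Qed.

Lemma dotvBl y z w : dotv (y - z) w = dotv y w - dotv z w.
Proof. exact: linearBl. Qed.

Lemma dotvBr y z w : dotv y (z - w) = dotv y z - dotv y w.
Proof. exact: linearBr. Qed.

Lemma dotvDl y z w : dotv (y + z) w = dotv y w + dotv z w.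
Proof. exact: linearDl. Qed.

Lemma dotvDr y z w : dotv y (z + w) = dotv y z + dotv y w.
Proof. exact: linearDr. Qed.

Lemma dotvNl y z : dotv (- y) z = - dotv y z.
Proof. exact: linearNl. Qed.

Lemma dotvNr y z : dotv y (- z) = - dotv y z.
Proof. exact: linearNr. Qed.

Lemma dotv0l y : dotv 0 y = 0.
Proof. exact: linear0l. Qed.

Lemma dotv0r y : dotv y 0 = 0.
Proof. exact: linear0r. Qed.

Lemma dotv_suml (I : finType) (F : I -> 'rV[R]_d) y :
  dotv (\sum_i F i) y = \sum_i dotv (F i) y.
Proof. exact: linear_sumlz. Qed.

Lemma dotv_sumr (I : finType) (F : I -> 'rV[R]_d) y :
  dotv y (\sum_i F i) = \sum_i dotv y (F i).
Proof. exact: linear_sumr. Qed.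

Lemma dotv_eq0 y : dotv y y = 0 -> y = 0.
Proof. by move=> yy; apply: contraTeq isT => /dotv_gt0; rewrite yy ltxx. Qed.

Lemma orthonormal_nth (s : seq 'rV[R]_d) (i j : nat) : orthonormal (@dotv R d) s ->
  (i < size s)%N -> (j < size s)%N -> dotv s`_i s`_j = (i == j)%:R.
Proof.
rewrite /orthonormal => /andP[]; elim: s i j => // y s IH i j /=.
case/andP=> /eqP yy s1 /andP[/andP[/allP ys _] so].
case: i j => [|i] [|j] //=; rewrite ?ltnS => li lj.
- by apply/eqP/ys/mem_nth.
- by rewrite dotvC; apply/eqP/ys/mem_nth.
- exact: IH.
Qed.

Definition onb_vec V (i : 'I_(\dim V)) : 'rV[R]_d := vsval (tnth (onb V) i).

Lemma onb_vecP V i j : dotv (@onb_vec V i) (@onb_vec V j) = (i == j)%:R.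
Proof.
have := onbP V; rewrite /is_onb => ob.
have e l : @onb_vec V l = (map vsval (onb V))`_l.
  by rewrite (nth_map 0) ?size_tuple // -tnth_nth.
by rewrite !e orthonormal_nth ?size_map ?size_tuple.
Qed.

Lemma onb_vec_expand V y : y \in V ->
  y = \sum_i dotv y (onb_vec i) *: @onb_vec V i.
Proof.
move=> yV; pose b := map_tuple vsval (onb V).
have bE (i : 'I_(\dim V)) : b`_i = onb_vec i.
  by rewrite -tnth_nth tnth_map.
have dotE (c : 'I_(\dim V) -> R) i :
    dotv (\sum_j c j *: b`_j) (onb_vec i) = c i.
  rewrite dotv_suml (bigD1 i) //= big1 => [|j ji]; last first.
    by rewrite dotvZl bE onb_vecP (negPf ji) /= mulr0.
  by rewrite dotvZl bE onb_vecP eqxx /= mulr1 addr0.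
have fb : free b.
  by apply/freeP => c c0 i; rewrite -(dotE c) c0 dotv0l.
have bV : basis_of V b.
  rewrite basisEfree fb size_tuple leqnn andbT.
  by apply/span_subvP => z /mapP[z' _ ->]; apply: subvsP.
rewrite {1}(coord_basis bV yV); apply: eq_bigr => i _; rewrite bE.
by congr (_ *: _); rewrite {2}(coord_basis bV yV) dotE.
Qed.

Lemma onb_expand V (y : subvs_of V) :
  y = \sum_i dotv (vsval y) (onb_vec i) *: tnth (onb V) i.
Proof.
apply: val_inj; rewrite [LHS](onb_vec_expand (subvsP y)) /= linear_sum.
by apply: eq_bigr => i _; rewrite linearZ.
Qed.

Lemma dotv_cap_orthov V : (V :&: orthov (@dotv R d) V = 0)%VS.
Proof.
apply/eqP; rewrite -subv0; apply/subvP => y; rewrite memv_cap memv0.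
by case/andP=> yV /mem_orthovP/(_ y yV) yy; apply/eqP/dotv_eq0.
Qed.

(** Subtracting from [y] its expansion along the orthonormal basis leaves a vector orthogonal to
    [V]. *)
Lemma dotv_add_orthov V y : y \in (V + orthov (@dotv R d) V)%VS.
Proof.
pose z := \sum_i dotv y (onb_vec i) *: @onb_vec V i.
have zV : z \in V by apply: memv_suml => i _; rewrite memvZ ?subvsP.
rewrite -[y](subrK z) addrC memv_add //; apply/mem_orthovP => w wV.
rewrite -[LHS]/(dotv (y - z) w) (onb_vec_expand wV) dotv_sumr.
apply: big1 => i _; rewrite dotvZr dotvBl dotv_suml (bigD1 i) //= big1.
  by rewrite dotvZl onb_vecP eqxx /= mulr1 addr0 subrr mulr0.
by move=> j ji; rewrite dotvZl onb_vecP (negPf ji) /= mulr0.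
Qed.

(** This is [oproj] with the whole ambient space as source, so that it applies to vectors known only
    in R^d, such as the gradients. *)
Definition proj V y : subvs_of V := vsproj V (daddv_pi V (orthov (@dotv R d) V) y).

Lemma proj_is_linear V : linear (proj V).
Proof. by move=> a y z; rewrite /proj !linearP. Qed.

HB.instance Definition _ V := GRing.isLinear.Build R 'rV[R]_d (subvs_of V) _
  (proj V) (proj_is_linear V).

Lemma oprojE V W (y : subvs_of V) : oproj W y = proj W (vsval y).
Proof. by []. Qed.

Lemma vsval_proj V y : vsval (proj V y) = daddv_pi V (orthov (@dotv R d) V) y.
Proof. by rewrite /proj vsprojK ?memv_pi. Qed.

Lemma dotv_proj V y w : w \in V -> dotv (vsval (proj V y)) w = dotv y w.
Proof.
move=> wV; have e := daddv_pi_add (dotv_cap_orthov V) (dotv_add_orthov V y).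
rewrite vsval_proj -{2}e dotvDl /= [X in _ = _ + X](_ : _ = 0) ?addr0 //.
have /mem_orthovP := memv_pi (orthov (@dotv R d) V) V y; exact.
Qed.

(** The difference of the two vectors lies in [V] and is orthogonal to [V], hence to itself. *)
Lemma proj_unique V y (z : subvs_of V) :
  {in V, forall w, dotv (vsval z) w = dotv y w} -> proj V y = z.
Proof.
move=> H; apply/eqP; rewrite -subr_eq0; apply/eqP/val_inj/dotv_eq0.
by rewrite dotvBl /= dotv_proj ?H ?subrr // memvB ?subvsP.
Qed.

Lemma proj_id V (y : subvs_of V) : proj V (vsval y) = y.
Proof. exact: proj_unique. Qed.

Lemma proj_proj V W y : (W <= V)%VS -> proj W (vsval (proj V y)) = proj W y.
Proof.
move=> WV; apply: proj_unique => w wW.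
by rewrite !dotv_proj // (subvP WV).
Qed.

(** On an orthonormal basis the Gram matrix is the identity, so the square of the value is 1. *)
Lemma volume_form_neq0 V (vol : kfunction (subvs_of V) (\dim V)) :
  volume_form vol -> vol <> 0.
Proof.
move=> [_ volE] vol0; have := volE (tnth (onb V)); rewrite vol0.
rewrite (_ : \matrix_(i, j) _ = 1%:M) ?det1; last first.
  by apply/matrixP => i j; rewrite !mxE onb_vecP.
by move/eqP; rewrite expr2 mulr0 eq_sym oner_eq0.
Qed.

(* The inclusion of E in V is adjoint to the projection of V onto E. *)
Lemma onb_contraction E V (f : subvs_of E -> R) (g : subvs_of V -> R) :
    (E <= V)%VS -> scalar f -> scalar g ->
  \sum_i f (oproj E (tnth (onb V) i)) * g (tnth (onb V) i) =
  \sum_j f (tnth (onb E) j) * g (proj V (vsval (tnth (onb E) j))).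
Proof.
move=> EV lf lg.
under eq_bigr => i _ do
  rewrite [oproj _ _]onb_expand (scalar_sum lf) mulr_suml.
rewrite exchange_big; apply: eq_bigr => j _ /=.
under eq_bigr => i _ do rewrite -mulrA mulrCA.
rewrite -mulr_sumr; congr (_ * _).
rewrite [in RHS](onb_expand (proj _ _)) (scalar_sum lg); apply: eq_bigr => i _.
by congr (_ * _); rewrite !dotv_proj ?subvsP // dotvC.
Qed.

End Projections.

(** * Tangent spaces and barycentric gradients *)

Section Tangent.
Variables (R : realType) (d : nat) (v : 'I_d.+1 -> 'rV[R]_d).
Implicit Types (e f : {set 'I_d.+1}).

Lemma tangent_edge f i j : i \in f -> j \in f -> v j - v i \in tangent v f.
Proof.
move=> fi fj; apply: memv_span; apply/allpairsP; exists (i, j).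
by rewrite !mem_enum.
Qed.

Lemma tangent_sub f (V : {vspace 'rV[R]_d}) :
  (forall i j, i \in f -> j \in f -> v j - v i \in V) -> (tangent v f <= V)%VS.
Proof.
move=> H; apply/span_subvP => y /allpairsP[[i j] /=].
by rewrite !mem_enum => -[fi fj ->]; apply: H.
Qed.

Lemma tangentS e f : e \subset f -> (tangent v e <= tangent v f)%VS.
Proof.
move=> /fintype.subsetP ef; apply: tangent_sub => i j ei ej.
by apply: tangent_edge; apply: ef.
Qed.

(* The vectors [n j] are the gradients of the barycentric coordinates. *)
Lemma barycentric_gradients : is_simplex v ->
  exists2 n : 'I_d.+1 -> 'rV[R]_d,
    forall j i i', dotv (n j) (v i - v i') = (j == i)%:R - (j == i')%:R &
    forall y i0, y = \sum_j dotv y (v j - v i0) *: n j.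
Proof.
rewrite /is_simplex; set X := [tuple _ | _ < _] => fX.
have XE (i : 'I_d) : X`_i = v (lift ord0 i) - v ord0 by rewrite -tnth_nth tnth_mktuple.
have bX : basis_of fullv X.
  by rewrite basisEfree fX subvf dimvf size_tuple /dim /= mul1n leqnn.
(* The vector representing, through the dot product, the i-th coordinate in the basis of edges
   issued from vertex 0. *)
pose g i : 'rV[R]_d := \row_a coord X i (delta_mx 0 a).
have gE i y : dotv (g i) y = coord X i y.
  rewrite [in RHS](row_sum_delta y) linear_sum; apply: eq_bigr => a _.
  by rewrite mxE linearZ mulrC.
(* Barycentric coordinates sum to 1, so their gradients sum to 0; this dictates the value at
   [ord0]. *)
pose n j := if unlift ord0 j is Some i then g i else - \sum_i g i.
have nl i : n (lift ord0 i) = g i by rewrite /n liftK.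
have n0 : n ord0 = - \sum_i g i by rewrite /n unlift_none.
have gX i l : dotv (g i) (v (lift ord0 l) - v ord0) = (i == l)%:R.
  by rewrite gE -XE coord_free // eq_sym.
have nv0 j i : dotv (n j) (v i - v ord0) = (j == i)%:R - (j == ord0)%:R.
  have [l ->|->] := unliftP ord0 i; last by rewrite subrr dotv0r subrr.
  have [m ->|->] := unliftP ord0 j.
    by rewrite nl gX (inj_eq lift_inj) [_ == ord0](negPf _) ?subr0.
  rewrite n0 dotvNl /= dotv_suml /= (bigD1 l) //= big1 ?addr0 => [|m ml].
    by rewrite gX eqxx sub0r.
  by rewrite gX (negPf ml).
have nv j i i' : dotv (n j) (v i - v i') = (j == i)%:R - (j == i')%:R.
  rewrite -[v i](subrK (v ord0)) -addrA dotvDr /= nv0 -[X in _ + X]opprK.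
  by rewrite -dotvNr opprB /= nv0 opprB addrA subrK.
exists n => // y i0; set s := \sum_j _; apply/eqP; rewrite -subr_eq0; apply/eqP.
(* In the pairing with [s] only j = m and j = 0 contribute, and the difference of the edges from
   [i0] to these vertices is the edge v m - v 0. So y - s is orthogonal to a basis. *)
have zX m : dotv (y - s) (v m - v ord0) = 0.
  rewrite dotvBl /= dotv_suml /=.
  under eq_bigr => j _ do rewrite dotvZl nv mulrBr.
  rewrite sumrB (bigD1 m) //= big1 => [|j jm]; last by rewrite (negPf jm) mulr0.
  rewrite (bigD1 ord0) //= big1 => [|j jm]; last by rewrite (negPf jm) mulr0.
  rewrite !eqxx !mulr1 !addr0 -dotvBr /= opprB addrA subrK.
  by rewrite -dotvBr /= subrr dotv0r.
apply: dotv_eq0; rewrite {2}(coord_basis bX (memvf (y - s))) dotv_sumr /=.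
by apply: big1 => i _; rewrite dotvZr XE zX mulr0.
Qed.

(** The edges from [i0] to the other vertices of [f] span, and pairing with the gradients shows that
    they are free. *)
Lemma dim_tangent f i0 : is_simplex v -> i0 \in f -> \dim (tangent v f) = #|f|.-1.
Proof.
move=> /barycentric_gradients[n nv _] fi0.
pose s := enum (f :\ i0); have ms j : (j \in s) = (j != i0) && (j \in f).
  by rewrite mem_enum !inE.
pose X := [seq v j - v i0 | j <- s].
have <- : size X = #|f|.-1.
  by rewrite size_map -cardE [#|f|](cardsD1 i0) fi0.
have tX : tangent v f = <<X>>%VS.
  apply/eqP; rewrite eqEsubv; apply/andP; split.
    have mX j : j \in f -> v j - v i0 \in <<X>>%VS.
      move=> fj; have [->|ji] := eqVneq j i0; first by rewrite subrr mem0v.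
      by apply/memv_span/map_f; rewrite ms ji.
    apply: tangent_sub => i j fi fj.
    by rewrite -(subrK (v i0) (v j)) -addrA memvD ?mX // -opprB memvN mX.
  by apply/span_subvP => y /mapP[j]; rewrite ms => /andP[_ fj] ->; apply: tangent_edge.
rewrite tX; apply/eqP; rewrite -/(free X).
have -> : X = in_tuple X by [].
apply/freeP => c c0 i.
have is_ (l : 'I_(size X)) : (l < size s)%N by rewrite -(size_map (fun j => v j - v i0)).
have : dotv (n (nth i0 s i)) (\sum_l c l *: (in_tuple X)`_l) = c i.
  rewrite dotv_sumr (bigD1 i) //= big1 => [|l li].
    rewrite dotvZr (nth_map i0) // nv eqxx addr0.
    have := mem_nth i0 (is_ i); rewrite ms => /andP[/negPf-> _].
    by rewrite subr0 mulr1.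
  rewrite dotvZr (nth_map i0) // nv nth_uniq ?enum_uniq //.
  have := mem_nth i0 (is_ i); rewrite ms => /andP[/negPf-> _].
  by rewrite [(i : nat) == l]eq_sym val_eqE (negPf li) subrr mulr0.
by rewrite c0 dotv0r => <-.
Qed.

End Tangent.

(** * Hodge stars in the adapted basis *)

Section AdaptedFamily.
Variables (R : realType) (d : nat) (v : 'I_d.+1 -> 'rV[R]_d).
Variables (e : {set 'I_d.+1}) (i0 : 'I_d.+1) (n : 'I_d.+1 -> 'rV[R]_d).
Hypothesis v_simplex : is_simplex v.
Hypothesis e_i0 : i0 \in e.
Hypothesis n_edge : forall j i i',
  dotv (n j) (v i - v i') = (j == i)%:R - (j == i')%:R.
Hypothesis n_expand : forall y i, y = \sum_j dotv y (v j - v i) *: n j.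

Local Notation E := (tangent v e).
Local Notation idx := ('I_(\dim E) + 'I_d.+1)%type.
Local Notation VT := (tangent v finset.setT).

(** Vertices of [e] keep an index but carry the vector 0, which avoids a dependent index type;
    [supp] removes them. *)
Definition adapted (i : idx) : 'rV[R]_d :=
  match i with inl a => onb_vec a | inr j => if j \in e then 0 else n j end.

Definition adapted_on (f : {set 'I_d.+1}) (i : idx) : subvs_of (tangent v f) :=
  proj (tangent v f) (adapted i).

Definition supp (f : {set 'I_d.+1}) : {set idx} :=
  [set i : idx | if i is inr j then (j \in f) && (j \notin e) else true].

(** For j outside [f], the gradient n j is orthogonal to every edge of [f], as the j-th barycentric
    coordinate vanishes on [f]. *)
Lemma adapted_on_supp f i : i \notin supp f -> adapted_on f i = 0.
Proof.
rewrite inE; case: i => // j; rewrite negb_and negbK /adapted_on /= => nj.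
case: ifPn => [_|je]; first by rewrite linear0.
rewrite (negPf je) orbF in nj.
apply: proj_unique => w wf; rewrite dotv0l; apply/esym.
have /subvP/(_ w wf) : (tangent v f <= orthov (@dotv R d) <[n j]>)%VS.
  apply: tangent_sub => a b af bf; rewrite mem_orthov1; apply/eqP.
  rewrite -[LHS]/(dotv (v b - v a) (n j)) dotvC n_edge.
  have ja (c : 'I_d.+1) : c \in f -> (j == c) = false.
    by move=> cf; apply: contraNF nj => /eqP->.
  by rewrite !ja ?subrr.
by rewrite mem_orthov1 dotvC => /eqP.
Qed.

(** Split y into its projection on E, expanded in the orthonormal basis, and a remainder z, expanded
    in the gradients. For j in [e] the coefficient z . (v j - v i0) is 0, since z is orthogonal to
    E, so the gradients dropped from [adapted] are not missed. *)
Lemma adapted_on_span f : forall y : subvs_of (tangent v f),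
  exists c : idx -> R, y = \sum_i c i *: adapted_on f i.
Proof.
move=> y; pose z := vsval y - vsval (proj E (vsval y)).
exists (fun i => match i with
  | inl a => dotv (vsval y) (onb_vec a) | inr j => dotv z (v j - v i0) end).
have ye : vsval y = \sum_a dotv (vsval y) (onb_vec a) *: @onb_vec _ _ E a +
    \sum_j dotv z (v j - v i0) *: n j.
  rewrite -n_expand -[LHS](subrK (vsval (proj E (vsval y)))) addrC -/z.
  congr (_ + _); rewrite [LHS](onb_vec_expand (subvsP (proj E _))).
  by apply: eq_bigr => a _; rewrite dotv_proj ?subvsP.
rewrite -[LHS]proj_id [in LHS]ye big_sumType /= linearD !linear_sum /=.
congr (_ + _); first by apply: eq_bigr => a _; rewrite linearZ.
apply: eq_bigr => j _; rewrite linearZ /adapted_on /=; case: ifP => // je.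
rewrite (_ : dotv z _ = 0) ?scale0r // /z dotvBl dotv_proj ?subrr //.
exact: tangent_edge.
Qed.

(** The count is (#|e| - 1) + (#|f| - #|e|) = #|f| - 1. *)
Lemma card_supp (f : {set 'I_d.+1}) : e \subset f -> #|supp f| = \dim (tangent v f).
Proof.
move=> ef; have fi0 : i0 \in f by apply: (fintype.subsetP ef).
rewrite (dim_tangent v_simplex fi0).
have -> : supp f = inl @: (finset.setT : {set 'I_(\dim E)}) :|: inr @: (f :\: e).
  apply/setP => -[a|j]; rewrite !inE /=.
    by rewrite imset_f ?inE.
  rewrite mem_imset; last by move=> ? ? [].
  rewrite !inE andbC; case: imsetP => [[]//|_].
  by rewrite orFb.
rewrite cardsU !card_imset; try by move=> ? ? [].
rewrite (_ : _ :&: _ = finset.set0) ?cards0 ?subn0; last first.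
  apply/setP => i; rewrite !inE; apply/negP => /andP[/imsetP[a _ ->] /imsetP[]//].
rewrite cardsT card_ord (dim_tangent v_simplex e_i0) cardsD (finset.setIidPr ef).
have := subset_leq_card ef; have : (0 < #|e|)%N by apply/card_gt0P; exists i0.
by case: #|e| => // a _; case: #|f| => // b; rewrite ltnS subSS => /subnKC.
Qed.

(** * Stars of forms on [e], evaluated on the adapted family *)

Section Star.
Variables (f : {set 'I_d.+1}).
Variables (vol : kfunction (subvs_of (tangent v f)) (\dim (tangent v f))).
Variables (m k : nat).
Hypothesis vol_form : volume_form vol.
Hypothesis e_sub_f : e \subset f.
Hypothesis dim_f : (m + k)%N = \dim (tangent v f).

Definition star (a : kfunction (subvs_of E) m) : kfunction (subvs_of VT) k :=
  embed VT (hodge vol (p := k) (embed (tangent v f) a)).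

Lemma star_linear c a b : star (c *: a + b) = c *: star a + star b.
Proof.
apply/funext => z; rewrite -[RHS]/(c * star a z + star b z).
rewrite /star /embed /hodge [X in _ = X + _]mulrCA -mulrDr; congr (_ * _).
rewrite mulr_sumr -big_split; apply: eq_bigr => i _ /=.
by rewrite mulrA -mulrDl.
Qed.

(** The star is a linear combination of forms obtained from [vol] by fixing its first [m] arguments
    and projecting the others. *)
Lemma star_Alt a : Alt _ _ a -> Alt _ _ (star a).
Proof.
move=> Aa.
pose b (i : {ffun 'I_m -> 'I_(\dim (tangent v f))}) q := tnth (onb _) (i q).
pose L : {linear subvs_of VT -> subvs_of (tangent v f)} := proj _ \o vsval.
pose F i : kfunction (subvs_of VT) k :=
  fun z => on_seq vol (codom (b i) ++ codom (L \o z) ++ [::]).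
have -> : star a = \sum_i ((m`!%:R)^-1 * embed (tangent v f) a (b i)) *: F i.
  apply/funext => z; rewrite fct_sumE /star /embed /hodge mulr_sumr.
  apply: eq_bigr => i _.
  rewrite -[RHS]/((_ * _) * _) -mulrA /F cats0.
  by [].
apply: subspace_sum => [|i _]; first exact: Alt_subspace.
apply: Alt_insert; first exact: vol_form.1.
by rewrite size_codom card_ord addn0.
Qed.

(** The form [a] sees the orthonormal basis of the tangent space of [f] only through its projection
    on E, so by [contraction] the sum may run over the orthonormal basis of E instead. *)
Lemma starE a z : multilinear a -> star a z =
  (m`!%:R)^-1 * \sum_(t : m.-tuple 'I_(\dim E))
    on_seq a (map (tnth (onb E)) t) *
    on_seq vol (map (adapted_on f \o inl) t ++ codom (fun q => oproj _ (z q))).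
Proof.
move=> ml; rewrite /star /embed /hodge; congr (_ * _).
set r := codom _; pose b := tnth (onb (tangent v f)).
rewrite (eq_bigr (fun i : {ffun 'I_m -> 'I__} =>
  on_seq a (map (oproj E \o b) (codom i)) * on_seq vol (map b (codom i) ++ r))).
  rewrite (sum_ffun_tuple _ (fun s => on_seq a (map (oproj E \o b) s) *
    on_seq vol (map b s ++ r))).
  apply: (contraction (F1 := on_seq a) (F2 := fun s => on_seq vol (s ++ r))).
  - by move=> F G; apply: onb_contraction; apply: tangentS.
  - exact: multilinear_slot.
  - move=> p q spq x1 c1 c2; rewrite -!catA.
    apply: (multilinear_slot vol_form.1.1).
    by rewrite size_cat addnA -addSn spq size_codom card_ord.
by move=> i _; rewrite !map_codom on_seq_codom.
Qed.

Lemma star_eval a W : Alt _ _ a -> size W = k ->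
  on_seq (star a) (map (adapted_on finset.setT) W) =
  (m`!%:R)^-1 * \sum_(t : m.-tuple 'I_(\dim E))
    on_seq a (map (tnth (onb E)) t) *
    on_seq vol (map (adapted_on f) (map inl t ++ W)).
Proof.
move=> [ml _] sW; rewrite /on_seq starE //; congr (_ * _).
apply: eq_bigr => t _; congr (_ * _).
rewrite map_cat -map_comp.
rewrite (_ : codom _ = map (adapted_on f) W) //.
rewrite -[RHS](codom_nth (k := k)) ?size_map //; apply: eq_codom => q.
(* The ordinal q forces W to be nonempty, which supplies a default for [nth_map]. *)
have i1 : idx by case: W sW q => [<- []|] //.
rewrite !(nth_map i1) ?sW // oprojE proj_proj //.
exact: tangentS (finset.subsetT _).
Qed.

Lemma vol_neq0 W : size W = \dim (tangent v f) ->
  (on_seq vol (map (adapted_on f) W) != 0) = perm_eq W (enum (supp f)).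
Proof.
move=> sW; apply: (on_seq_spanning_neq0 (adapted_on_span (f := f))) => //.
- exact: adapted_on_supp.
- exact: vol_form.1.
- exact: volume_form_neq0.
- exact: card_supp.
Qed.

Lemma vol_cat_neq0 (t : m.-tuple 'I_(\dim E)) W : size W = k ->
  (on_seq vol (map (adapted_on f) (map inl t ++ W)) != 0) =
  perm_eq (map inl t ++ W) (enum (supp f)).
Proof. by move=> sW; rewrite vol_neq0 // size_cat size_map size_tuple sW. Qed.

Lemma star_eval_neq0 a W : Alt _ _ a -> size W = k ->
  on_seq (star a) (map (adapted_on finset.setT) W) != 0 ->
  exists t : m.-tuple 'I_(\dim E), perm_eq (map inl t ++ W) (enum (supp f)).
Proof.
move=> Aa sW; rewrite star_eval // => ne0.
have [t pt|H] := pickP (fun t : m.-tuple 'I_(\dim E) =>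
  perm_eq (map inl t ++ W) (enum (supp f))); first by exists t.
rewrite big1 ?mulr0 ?eqxx // in ne0 => t _.
by apply/eqP; rewrite mulf_eq0 -[X in _ || X]negbK vol_cat_neq0 // H orbT.
Qed.

(* Restricting [vol] after filling its last arguments with the members of [B]
   makes the value of the star at [B] a sum of squares. *)
Lemma star_dual (B : {set idx}) : #|B| = k ->
    (exists t : m.-tuple 'I_(\dim E), perm_eq (map inl t ++ enum B) (enum (supp f))) ->
  exists2 a, Alt _ _ a &
    on_seq (star a) (map (adapted_on finset.setT) (enum B)) != 0 /\
    forall B' : {set idx}, #|B'| = k -> B' != B ->
      on_seq (star a) (map (adapted_on finset.setT) (enum B')) = 0.
Proof.
move=> cB [t0 pt0].
have sz (C : {set idx}) : #|C| = k -> size (enum C) = k by rewrite cardE.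
pose L : {linear subvs_of E -> subvs_of (tangent v f)} := proj _ \o vsval.
pose a : kfunction (subvs_of E) m :=
  fun y => on_seq vol ([::] ++ codom (L \o y) ++ map (adapted_on f) (enum B)).
have Aa : Alt _ _ a.
  by apply: Alt_insert; [exact: vol_form.1|rewrite add0n size_map sz].
have aE (t : m.-tuple 'I_(\dim E)) : on_seq a (map (tnth (onb E)) t) =
    on_seq vol (map (adapted_on f) (map inl t ++ enum B)).
  rewrite map_cat -map_comp /on_seq /a /= -map_codom codom_nth ?size_map ?size_tuple //.
  by rewrite -map_comp.
exists a => //; split=> [|B' cB' B'B].
  rewrite star_eval ?sz // mulf_neq0 //.
    by rewrite invr_neq0 // pnatr_eq0 -lt0n fact_gt0.
  have ne0 := vol_cat_neq0 t0 (sz _ cB); rewrite pt0 in ne0.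
  apply/eqP => s0; move: ne0; rewrite -sqrf_eq0 expr2 -{1}aE; apply/negP.
  rewrite negbK; apply/eqP; apply: (psumr_eq0P _ s0) => // t _.
  by rewrite aE -expr2 sqr_ge0.
rewrite star_eval ?sz // big1 ?mulr0 // => t _; rewrite aE; apply/eqP.
(* If both factors were nonzero, t with B and t with B' would both enumerate [supp f], and
   cancelling t would give B' = B. *)
apply: contraNT B'B; rewrite mulf_eq0 negb_or !vol_cat_neq0 ?sz //.
case/andP=> pB pB'; have : perm_eq (map inl t ++ enum B') (map inl t ++ enum B).
  by apply: perm_trans pB' _; rewrite perm_sym.
rewrite perm_cat2l => /perm_mem BB; apply/eqP/finset.setP => i.
by have := BB i; rewrite !mem_enum.
Qed.

End Star.

End AdaptedFamily.

(** * The subsimplex attached to a k-subset of the adapted family *)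

Section Classes.
Variables (R : realType) (d : nat) (v : 'I_d.+1 -> 'rV[R]_d).
Variables (e : {set 'I_d.+1}) (i0 : 'I_d.+1).
Hypothesis v_simplex : is_simplex v.
Hypothesis e_i0 : i0 \in e.
Local Notation idx := ('I_(\dim (tangent v e)) + 'I_d.+1)%type.

Definition carrier (B : {set idx}) : {set 'I_d.+1} :=
  e :|: [set j : 'I_d.+1 | inr j \in B].

(** The indices that a tuple t must supply for t and [B] to make up the support of the carrier. *)
Definition absent (B : {set idx}) : {set 'I_(\dim (tangent v e))} :=
  [set a : 'I__ | inl a \notin B].

Lemma sub_carrier (B : {set idx}) : e \subset carrier B.
Proof. exact: finset.subsetUl. Qed.

Lemma carrier_perm (f : {set 'I_d.+1}) (t : seq 'I_(\dim (tangent v e)))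
    (B : {set idx}) :
  e \subset f -> perm_eq (map inl t ++ enum B) (enum (supp v e f)) ->
  carrier B = f.
Proof.
move=> /fintype.subsetP ef /perm_mem tB; apply/finset.setP => j; rewrite !inE.
have := tB (inr j); rewrite mem_cat !mem_enum !inE.
have -> : (inr j \in map inl t) = false by apply/mapP => -[].
by move=> /= ->; case: (boolP (j \in e)) => [/ef->//|_]; rewrite andbT.
Qed.

(** The hypothesis excludes from [B] the indices [inr j] with j in [e], which lie in no support. *)
Lemma perm_carrier (B : {set idx}) : B \subset supp v e finset.setT ->
  perm_eq (map inl (enum (absent B)) ++ enum B) (enum (supp v e (carrier B))).
Proof.
move=> /fintype.subsetP BT; apply: uniq_perm; rewrite ?enum_uniq //.
  rewrite cat_uniq enum_uniq map_inj_uniq ?enum_uniq ?andbT //=; last by move=> ? ? [].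
  apply/hasPn => i; rewrite mem_enum => iB; apply/mapP => -[a].
  by rewrite mem_enum inE => aB ia; rewrite -ia iB in aB.
move=> i; rewrite mem_cat !mem_enum; case: i => [a|j].
  rewrite mem_map; last by move=> ? ? [].
  by rewrite mem_enum !inE orNb.
have -> : (inr j \in map inl (enum (absent B))) = false by apply/mapP => -[].
rewrite !inE /=; have := BT (inr j); rewrite !inE /= => H.
by apply/idP/idP => [jB|/andP[/orP[->//|]]//]; rewrite jB orbT H.
Qed.

Lemma dim_carrier (B : {set idx}) : B \subset supp v e finset.setT ->
  (#|absent B| + #|B|)%N = \dim (tangent v (carrier B)).
Proof.
move=> /perm_carrier/perm_size; rewrite size_cat size_map -!cardE => ->.
by apply: (card_supp v_simplex e_i0); apply: sub_carrier.
Qed.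

End Classes.

(** * Decomposition of the k-forms into stars of forms on [e] *)

Theorem theorem4p2 (R : realType) (d : nat) (hd : (2 <= d)%N)
    (v : 'I_d.+1 -> 'rV[R]_d) (hv : is_simplex v)
    (s k : nat) (hs : (s <= d)%N) (hk : (k <= d)%N)
    (e : {set 'I_d.+1}) (he : e \in subsimplices d s)
    (vol : forall f : {set 'I_d.+1},
       kfunction (subvs_of (tangent v f)) (\dim (tangent v f)))
    (hvol : forall f : {set 'I_d.+1}, f != finset.set0 -> volume_form (vol f)) :
  let T : {set 'I_d.+1} := finset.setT in
  is_direct_sum (Alt (subvs_of (tangent v T)) k)
    (fun lf : 'I_d.+1 * {set 'I_d.+1} => let: (l, f) := lf in
       [&& (maxn s k <= l)%N, (l <= minn (k + s) d)%N,
           f \in subsimplices d l & e \subset f])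
    (fun lf : 'I_d.+1 * {set 'I_d.+1} => let: (l, f) := lf in
       embed (tangent v T) @`
         (hodge (vol f) (p := k) @`
           (embed (tangent v f) @` Alt (subvs_of (tangent v e)) (l - k)%N))).
Proof.
move=> T; have [n n_edge n_expand] := barycentric_gradients hv.
have card_e : #|e| = s.+1 by move: he; rewrite inE => /eqP.
have [i0 e_i0] : exists i0, i0 \in e by apply/card_gt0P; rewrite card_e.
have dimE (f : {set 'I_d.+1}) : e \subset f -> \dim (tangent v f) = #|f|.-1.
  by move=> /fintype.subsetP ef; apply: (dim_tangent hv (ef _ e_i0)).
have volf (f : {set 'I_d.+1}) : e \subset f -> volume_form (vol f).
  move=> /fintype.subsetP ef; apply: hvol; apply/set0Pn; exists i0; exact: ef.
(* The bound k <= l makes the truncated subtraction l - k exact. *)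
have dimP (l : 'I_d.+1) (f : {set 'I_d.+1}) :
    [&& (maxn s k <= l)%N, (l <= minn (k + s) d)%N,
        f \in subsimplices d l & e \subset f] ->
    [/\ e \subset f, (l - k + k)%N = \dim (tangent v f) &
        l = \dim (tangent v f) :> nat].
  rewrite inE geq_max => /and4P[/andP[_ kl] _ /eqP cf ef]; split=> //.
    by rewrite dimE // cf subnK.
by rewrite dimE // cf.
pose ev (B : {set 'I_(\dim (tangent v e)) + 'I_d.+1})
    (w : kfunction (subvs_of (tangent v T)) k) : R :=
  on_seq w (map (adapted_on n T) (enum B)).
(* The only pair whose summand can be nonzero at [B]; the dimension is one less than the number of
   vertices. *)
pose cls (B : {set 'I_(\dim (tangent v e)) + 'I_d.+1}) : 'I_d.+1 * {set 'I_d.+1} :=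
  (inord #|carrier B|.-1, carrier B).
have carrierE (B : {set 'I_(\dim (tangent v e)) + 'I_d.+1}) : B \subset supp v e T ->
    (inord #|carrier B|.-1 : 'I_d.+1) = (#|absent B| + #|B|)%N :> nat.
  move=> BT; rewrite (dim_carrier hv e_i0 BT) dimE ?sub_carrier // inordK //.
  have := max_card [in carrier B]; rewrite card_ord.
  by case: #|_| => // ?; rewrite ltnS => /ltnW.
pose D := [pred B : {set 'I_(\dim (tangent v e)) + 'I_d.+1} |
  (B \subset supp v e T) && (#|B| == k)].
apply: (@direct_sum_dual_family R (kfunction (subvs_of (tangent v T)) k) _ _ _ _ _ D ev cls).
- exact: Alt_subspace.
(* Composing the three images turns the summand into the image of the forms on E under [star]. *)
- move=> [l f] /dimP[ef df dl]; rewrite !image_comp; split.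
    by apply: subspace_image (@Alt_subspace _ _ _) => c a b; apply: star_linear.
  by move=> _ [a Aa <-]; apply: (star_Alt (volf _ ef) df).
- move=> B c w1 w2; reflexivity.
- move=> w Aw w0; apply: (Alt_spanned_eq0 (adapted_on_span e_i0 n_expand (f := T))
    (adapted_on_supp n_edge (f := T)) Aw) => B BT cB.
  by apply: w0; rewrite /D /= BT cB eqxx.
(* Here l = #|absent B| + k, and #|absent B| is at most dim E = s, so k <= l <= k + s. Moreover s <=
   l because the carrier contains [e], and l <= d because it has at most d + 1 vertices. *)
- move=> B /andP[BT /eqP cB]; rewrite /cls.
  have cf := carrierE B BT; rewrite cB in cf.
  have dimf := dim_carrier hv e_i0 BT.
  rewrite cf inE geq_max leq_min leq_addl sub_carrier andbT.
  have cl : #|carrier B| = (#|absent B| + k).+1.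
    rewrite -cB dimf dimE ?sub_carrier // prednK //.
    by apply/card_gt0P; exists i0; apply: (fintype.subsetP (sub_carrier B)).
  rewrite cl eqxx andbT -ltnS -cl -card_e subset_leq_card ?sub_carrier //=.
  have ab : (#|absent B| <= s)%N.
    by apply: leq_trans (max_card _) _; rewrite card_ord dimE // card_e.
  rewrite addnC leq_add2l ab -ltnS addnC -cl !andbT.
  by apply: leq_trans (max_card _) _; rewrite card_ord.
(* A nonzero value yields a tuple completing [B] to [supp f]; this identifies [f] with the carrier,
   and then l through the dimension. *)
- move=> [l f] B w /dimP[ef df dl] /andP[BT /eqP cB] [_ [_ [a Aa <-] <-] <-] ne0.
  have [|t pt] := star_eval_neq0 hv e_i0 n_edge n_expand (volf _ ef) ef df Aa _ ne0.
    by rewrite -cardE.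
  have cf := carrier_perm ef pt.
  rewrite /cls; congr (_, _) => //; apply: val_inj => /=.
  rewrite (carrierE B BT) (dim_carrier hv e_i0 BT) cf; exact: esym dl.
- move=> B /andP[BT /eqP cB]; rewrite /cls.
  have ef := sub_carrier B; have dimf := dim_carrier hv e_i0 BT.
  set l : 'I_d.+1 := inord _.
  (* The degree l - k is the number of orthonormal vectors of E missing from [B], so these fill the
     tuple that [star_dual] requires. *)
  have lk : (l - k)%N = #|absent B| by rewrite /l carrierE // cB addnK.
  have df : (l - k + k)%N = \dim (tangent v (carrier B)) by rewrite lk -cB.
  have sz : size (enum (absent B)) == (l - k)%N by rewrite lk -cardE.
  have [|a Aa [ne0 a0]] := star_dual hv e_i0 n_edge n_expand (volf _ ef) ef df cB.
    by exists (Tuple sz); apply: perm_carrier.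
  exists (star (vol (carrier B)) (k := k) a).
    by exists (hodge (vol (carrier B)) (embed _ a)) => //; exists (embed _ a) => //; exists a.
  by split=> // B' /andP[_ /eqP cB']; apply: a0.
Qed.
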